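(* Let $u_0\in\mathrm{BV}_{\mathrm{loc}}([0,+\infty))$ be right-continuous and nonnegative, and suppose that there exists $\alpha>0$ such that $u_0(t)\ge\alpha$ for all $t\in[0,\alpha)$. Then the equation $$\ell(t)=u_0(t)+\bigl|\{\,s\in[0,t]:\ \ell(t-s)>s\,\}\bigr|\qquad\forall t\in[0,+\infty)$$ admits a unique solution $\ell:[0,+\infty)\to[0,+\infty)$, $\ell\in\mathrm{BV}_{\mathrm{loc}}([0,+\infty))$. Furthermore $\ell(t)\ge\alpha$ for all $t\in[0,+\infty)$, $\ell(t)\le\|u_0\|_\infty+t$ for all $t\in[0,+\infty)$, and $$\ell(t+\tau)-\ell(t)\le u_0(t+\tau)-u_0(t)+\tau,\qquad t>0,\ \tau\ge0.$$
   Context: $|\cdot|$ denotes one-dimensional Lebesgue measure. $\mathrm{BV}_{\mathrm{loc}}([0,+\infty))$ is the class of all functions on $[0,+\infty)$ having finite pointwise variation on $[0,a]$ for every $a>0$. All functions are Lebesgue measurable. $\|u_0\|_\infty\in[0,+\infty]$ is the supremum norm of $u_0$ on $[0,+\infty)$. *)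

(* Defs.v *)
From HB Require Import structures.
From mathcomp Require Import all_boot all_order all_algebra.
From mathcomp Require Import all_classical all_reals all_analysis.

Set Implicit Arguments.
Unset Strict Implicit.
Unset Printing Implicit Defensive.

Import Order.TTheory GRing.Theory Num.Theory.
Import numFieldNormedType.Exports.

Local Open Scope classical_set_scope.
Local Open Scope ring_scope.

(* A function on [0, +oo[ is encoded as a function R -> R whose values at
   negative arguments are never constrained or used: every notion below only
   depends on the restriction to [0, +oo[. *)

Definition BVloc (R : realType) (f : R -> R) : Prop :=
  forall a : R, 0 < a -> bounded_variation 0 a f.

Definition nonneg_on_halfline (R : realType) (f : R -> R) : Prop :=
  forall t : R, 0 <= t -> 0 <= f t.

Definition right_continuous_on_halfline (R : realType) (f : R -> R) : Prop :=
  forall t : R, 0 <= t -> f x @[x --> t^'+] --> f t.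

(* Pointwise, not essential, supremum; possibly +oo. *)
Definition supnorm (R : realType) (f : R -> R) : \bar R :=
  ereal_sup [set `|f t|%:E | t in `[0, +oo[].

(* For l of locally bounded variation the set below is Borel, so that
   lebesgue_measure is its Lebesgue measure. *)
Definition solves_equation (R : realType) (u0 l : R -> R) : Prop :=
  forall t : R, 0 <= t ->
    ((l t)%:E = (u0 t)%:E +
       lebesgue_measure [set s : R | (0 <= s <= t)%R /\ (s < l (t - s))%R])%E.

Definition is_solution (R : realType) (u0 l : R -> R) : Prop :=
  [/\ nonneg_on_halfline l, BVloc l & solves_equation u0 l].

(* Main.v *)
Require Import Defs.
From HB Require Import structures.
From mathcomp Require Import all_boot all_order all_algebra.
From mathcomp Require Import all_classical all_reals all_analysis.
From mathcomp Require Import measurable_realfun lra.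

(** The equation is a delay equation in disguise.  Every nonnegative solution
    is bounded below by [alpha] ([solution_ge]).  For a function bounded below
    by [alpha], each delay [s < alpha] with [0 <= s <= t] satisfies
    [s < l (t - s)], whatever the precise values of [l]; hence the right-hand
    side at time [t] sees [l] only at instants at most [t - alpha]
    ([active_delays_eq]).  Solving for [t < alpha], then for [t < 2 alpha], and
    so on, gives uniqueness ([solution_unique]).  Existence follows as well:
    the iterates of the right-hand side from the constant [alpha] become
    stationary for [t < n alpha] after [n] steps ([iterates_stabilize]), and
    their eventual value solves the equation ([eventual_iterate_solves]).

    Regularity comes from a one-sided estimate on the measure [m t] of the set
    of active delays at [t], those [s] with [0 <= s <= t] and [s < l (t - s)].
    A delay active at time [t + tau] either is at most [tau] or is, after
    subtracting [tau], active at time [t]; thus [m (t + tau) <= m t + tau]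
    ([active_measure_shift]).  This is the announced increment inequality, and
    it also exhibits [l] as [u0 + id] minus a nondecreasing function, whence
    its locally bounded variation ([solution_BVloc]).

    The sets of active delays are compared by inclusions only, so what the
    argument uses of Lebesgue measure is what holds for the outer measure of an
    arbitrary set: monotonicity, subadditivity ([lebesgue_outerU]) and
    translation invariance ([lebesgue_outer_addr]). *)

Set Implicit Arguments.
Unset Strict Implicit.
Unset Printing Implicit Defensive.

Import Order.TTheory GRing.Theory Num.Theory.
Import numFieldNormedType.Exports.

Local Open Scope classical_set_scope.
Local Open Scope ring_scope.

(** * Lebesgue outer measure of arbitrary sets *)

Section OuterMeasure.
Context {R : realType}.
Implicit Types (A B : set R) (a b tau : R).
Local Notation mu := (@lebesgue_measure R).

Lemma le_lebesgue_outer A B : A `<=` B -> (mu A <= mu B)%E.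
Proof. by move=> AB; exact: le_mu_ext. Qed.

Lemma lebesgue_outerU A B : (mu (A `|` B) <= mu A + mu B)%E.
Proof. exact: (outer_measureU2 (mu_ext (@wlength R idfun))). Qed.

Lemma lebesgue_outer_ge a b A :
  (forall x, a < x -> x < b -> A x) -> ((b - a)%:E <= mu A)%E.
Proof.
move=> abA; have [ab|ba] := ltP a b; last first.
  by rewrite (le_trans _ (measure_ge0 _ _))// lee_fin subr_le0.
rewrite (_ : (b - a)%:E = mu `]a, b[).
  by apply: le_lebesgue_outer => x; rewrite /= in_itv/= => /andP[]; exact: abA.
by rewrite lebesgue_measure_itv/= lte_fin ab EFinB.
Qed.

Lemma lebesgue_outer_le a b A : a <= b ->
  (forall x, A x -> a <= x <= b) -> (mu A <= (b - a)%:E)%E.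
Proof.
move=> ab Aab; apply: (@le_trans _ _ (mu `[a, b])).
  by apply: le_lebesgue_outer => x /Aab; rewrite /= in_itv.
rewrite lebesgue_measure_itv/= lte_fin; case: ltP => // _.
by rewrite lee_fin subr_ge0.
Qed.

Lemma measurable_addr tau :
  measurable_fun [set: measurableTypeR R] (fun x : R => x + tau).
Proof. by apply: measurable_funD => //; exact: measurable_cst. Qed.

Lemma lebesgue_measure_addr tau A : measurable A ->
  mu ((fun x => x + tau) @^-1` A) = mu A.
Proof.
move=> mA; pose addtau : _ -> measurableTypeR R := fun x : R => x + tau.
have mtau := measurable_addr tau.
suff -> : mu A = pushforward mu addtau A by [].
apply: lebesgue_measure_unique => //= _ [[a b]] _ <-.
rewrite /pushforward (_ : addtau @^-1` _ = `]a - tau, b - tau]%classic);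
  last by apply/seteqP; split => x; rewrite /= !in_itv/= ltrBlDr lerBrDr.
rewrite !lebesgue_measure_itv/= !lte_fin ltrD2r -!EFinB.
by rewrite (_ : b - tau - (a - tau) = b - a)//; lra.
Qed.

(** Open supersets reduce translation invariance for arbitrary sets to the
    measurable case. *)
Lemma lebesgue_outer_addr tau A : (mu ((fun x => x + tau)%R @^-1` A) <= mu A)%E.
Proof.
apply/lee_addgt0Pr => e /(outer_measure_open_le A)[U [oU AU UA]].
apply: le_trans UA; rewrite -(lebesgue_measure_addr tau (open_measurable oU)).
by apply: le_lebesgue_outer => x; exact: AU.
Qed.

End OuterMeasure.

Lemma lt_natmul_exists (R : realType) (a t : R) : 0 < a -> 0 <= t ->
  exists n, t < n%:R * a.
Proof.
move=> a0 t0; exists (Num.truncn (t / a)).+1.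
by rewrite -ltr_pdivrMr// truncnS_gt.
Qed.

(** * Active delays *)

Section ActiveDelays.
Context {R : realType}.
Implicit Types (l : R -> R) (t tau : R).
Local Notation mu := (@lebesgue_measure R).

Definition active_delays l t : set R :=
  [set s : R | (0 <= s <= t)%R /\ (s < l (t - s))%R].

Definition active_measure l t : R := fine (mu (active_delays l t)).

Lemma active_delays_le l t : 0 <= t -> (mu (active_delays l t) <= t%:E)%E.
Proof.
by move=> t0; rewrite -[t in t%:E]subr0; apply: lebesgue_outer_le => // s [].
Qed.

Lemma active_measureE l t : 0 <= t ->
  ((active_measure l t)%:E = mu (active_delays l t))%E.
Proof.
move=> t0; rewrite fineK// ge0_fin_numE ?measure_ge0//.
by rewrite (le_lt_trans (active_delays_le l t0))// ltry.
Qed.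

Lemma active_measure_ge0 l t : 0 <= active_measure l t.
Proof. by rewrite fine_ge0// measure_ge0. Qed.

Lemma active_measure_le l t : 0 <= t -> active_measure l t <= t.
Proof. by move=> t0; rewrite -lee_fin active_measureE// active_delays_le. Qed.

Lemma active_measure_ge l t a b : 0 <= t ->
  (forall s, a < s -> s < b -> active_delays l t s) ->
  b - a <= active_measure l t.
Proof.
by move=> t0 abl; rewrite -lee_fin active_measureE//; exact: lebesgue_outer_ge.
Qed.

(** A delay [s] active at [t + tau] with [s > tau] makes [s - tau] active at
    [t], since both look at the same past instant [t + tau - s]. *)
Lemma active_measure_shift l t tau : 0 <= t -> 0 <= tau ->
  active_measure l (t + tau) <= active_measure l t + tau.
Proof.
move=> t0 tau0; have ttau0 : 0 <= t + tau by rewrite addr_ge0.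
rewrite -lee_fin EFinD !active_measureE//.
apply: (@le_trans _ _ (mu ((fun s => s + - tau) @^-1` active_delays l t `|`
                           [set` `[0, tau]]))).
  apply: le_lebesgue_outer => s [/andP[s0 st] sl] /=; rewrite in_itv/= s0/=.
  have [stau|taus] := leP s tau; [by right|left].
  split; first by apply/andP; split; lra.
  rewrite (_ : t - (s - tau) = t + tau - s); lra.
apply: le_trans (lebesgue_outerU _ _) _; apply: leeD.
  exact: lebesgue_outer_addr.
by rewrite -[tau in leRHS]subr0; exact: lebesgue_outer_le.
Qed.

(** The delays below [alpha] are active for both functions; a longer delay
    looks at an instant at most [t - alpha], where the functions agree. *)
Lemma active_delays_eq (alpha : R) l l' t :
  (forall r, 0 <= r -> alpha <= l r) -> (forall r, 0 <= r -> alpha <= l' r) ->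
  (forall r, 0 <= r -> r <= t - alpha -> l r = l' r) ->
  active_delays l t = active_delays l' t.
Proof.
move=> la l'a ll'; apply/seteqP.
by split=> s [/andP[s0 st] sl]; split; rewrite ?s0//;
  have [sa|As] := ltP s alpha;
  [apply: lt_le_trans (l'a _ _); lra | rewrite -ll'; lra
  |apply: lt_le_trans (la _ _); lra | rewrite ll'; lra].
Qed.

End ActiveDelays.

Section Equation.
Context {R : realType}.
Variables (u0 : R -> R) (alpha : R).
Hypothesis u0_ge0 : nonneg_on_halfline u0.
Hypothesis alpha_gt0 : 0 < alpha.
Hypothesis u0_alpha : forall t : R, 0 <= t -> t < alpha -> alpha <= u0 t.
Implicit Types (l : R -> R) (t : R) (n : nat).

Definition delay_rhs l t : R := u0 t + active_measure l t.

Lemma solves_equationP l :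
  solves_equation u0 l <-> forall t, 0 <= t -> l t = delay_rhs l t.
Proof.
split=> eql t t0; last by rewrite eql// EFinD active_measureE.
by apply: EFin_inj; rewrite eql// EFinD active_measureE.
Qed.

(** * Lower bound for solutions *)

(** Before [alpha] the bound comes from [u0]; afterwards it comes from the
    activity of all the delays below [alpha], a set of measure [alpha]. *)
Lemma delay_rhs_ge l t : 0 <= t ->
  (forall s, 0 < s -> s < alpha -> s <= t -> s < l (t - s)) ->
  alpha <= delay_rhs l t.
Proof.
move=> t0 tl; rewrite /delay_rhs; have [ta|At] := ltP t alpha.
  by rewrite (le_trans (u0_alpha t0 ta))// lerDl active_measure_ge0.
have : alpha - 0 <= active_measure l t.
  apply: active_measure_ge => // s s0 sa.
  by split; [apply/andP; split; lra|apply: tl => //; lra].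
by have := u0_ge0 t0; lra.
Qed.

(** Induction by steps of length [alpha / 2].  Once the bound holds before time
    [T], then for [alpha <= t < T + alpha / 2] it makes the delays between
    [alpha / 2] and [alpha] active, so that [l >= alpha / 2] there, as it is
    before [alpha] because of [u0].  This rough bound makes
    the delays that still look at instants after [T], which are shorter than
    [alpha / 2], active too. *)
Lemma solution_ge l : solves_equation u0 l -> forall t, 0 <= t -> alpha <= l t.
Proof.
move=> /solves_equationP eql.
suff step n t : 0 <= t -> t < n%:R * (alpha / 2) -> alpha <= l t.
  move=> t t0; have a2 : 0 < alpha / 2 by rewrite divr_gt0.
  by have [n tn] := lt_natmul_exists a2 t0; exact: step tn.
elim: n t => [|n IHn] t t0 tn; first by rewrite mul0r in tn; lra.
set T := n%:R * (alpha / 2) in IHn.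
have {}tn : t < T + alpha / 2 by move: tn; rewrite -natr1 /T; lra.
have rough r : 0 <= r -> r < T + alpha / 2 -> alpha / 2 <= l r.
  move=> r0 rT; rewrite eql// /delay_rhs; have [ra|Ar] := ltP r alpha.
    by have := u0_alpha r0 ra; have := active_measure_ge0 l r; lra.
  suff : alpha - alpha / 2 <= active_measure l r by have := u0_ge0 r0; lra.
  apply: active_measure_ge => // s s1 s2.
  split; first by apply/andP; split; lra.
  by apply: lt_le_trans (IHn _ _ _); lra.
rewrite eql//; apply: delay_rhs_ge => // s s0 sa st.
have [tsT|Tts] := ltP (t - s) T; first by apply: lt_le_trans (IHn _ _ _); lra.
by apply: lt_le_trans (rough _ _ _); lra.
Qed.

(** * Uniqueness and existence *)

Lemma solution_unique l l' :
  solves_equation u0 l -> solves_equation u0 l' ->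
  forall t, 0 <= t -> l' t = l t.
Proof.
move=> eql eql'.
have [la l'a] := (solution_ge eql, solution_ge eql').
move/solves_equationP in eql; move/solves_equationP in eql'.
suff step n t : 0 <= t -> t < n%:R * alpha -> l' t = l t.
  by move=> t t0; have [n tn] := lt_natmul_exists alpha_gt0 t0; exact: step tn.
elim: n t => [|n IHn] t t0 tn; first by rewrite mul0r in tn; lra.
rewrite eql// eql'// /delay_rhs /active_measure.
rewrite (active_delays_eq l'a la)// => r r0 rt; apply: IHn => //.
by move: tn; rewrite -natr1; lra.
Qed.

Definition iterate n : R -> R := iter n delay_rhs (cst alpha).

Lemma iterate_ge n t : 0 <= t -> alpha <= iterate n t.
Proof.
elim: n t => [|n IHn] t t0 //=; apply: delay_rhs_ge => // s s0 sa st.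
by apply: lt_le_trans (IHn _ _); lra.
Qed.

Lemma iterates_stabilize n t m : 0 <= t -> t < n%:R * alpha -> (n <= m)%N ->
  iterate m t = iterate n t.
Proof.
elim: n t m => [|n IHn] t [|m]// t0; rewrite ?mul0r; try by move=> ? _; lra.
move=> tn nm; rewrite /= /delay_rhs /active_measure.
rewrite (active_delays_eq (iterate_ge m) (iterate_ge n))// => r r0 rt.
by apply: IHn => //; move: tn; rewrite -natr1; lra.
Qed.

(** The index is the first [n] with [t < n alpha], from which on the iterates
    no longer change at [t]. *)
Definition eventual_iterate t : R := iterate (Num.truncn (t / alpha)).+1 t.

Lemma eventual_iterateE n t : 0 <= t -> t < n%:R * alpha ->
  eventual_iterate t = iterate n t.
Proof.
move=> t0 tn; symmetry; apply: iterates_stabilize => //.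
  by rewrite -ltr_pdivrMr// truncnS_gt.
by rewrite truncn_lt_nat ?ltr_pdivrMr// divr_ge0// ltW.
Qed.

Lemma eventual_iterate_solves : solves_equation u0 eventual_iterate.
Proof.
apply/solves_equationP => t t0; have [n tn] := lt_natmul_exists alpha_gt0 t0.
rewrite (@eventual_iterateE n.+1)//; last first.
  by have := alpha_gt0; rewrite -natr1; lra.
rewrite /= /delay_rhs /active_measure (_ : active_delays _ t =
  active_delays eventual_iterate t)//.
have En s : 0 <= s -> s <= t -> eventual_iterate (t - s) = iterate n (t - s).
  by move=> s0 st; apply: eventual_iterateE; lra.
by apply/seteqP; split=> s [/andP[s0 st] sl]; split; rewrite ?s0//;
  move: sl; rewrite En.
Qed.

(** * Regularity *)

Lemma solution_increment l : solves_equation u0 l ->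
  forall t tau, 0 <= t -> 0 <= tau ->
  l (t + tau) - l t <= u0 (t + tau) - u0 t + tau.
Proof.
move=> /solves_equationP eql t tau t0 tau0; rewrite !eql ?addr_ge0// /delay_rhs.
by have := active_measure_shift l t0 tau0; lra.
Qed.

(** The increment inequality says that [u0 + id - l] is nondecreasing. *)
Lemma solution_BVloc l : BVloc u0 -> solves_equation u0 l -> BVloc l.
Proof.
move=> u0_BV eql a a0.
pose gap := u0 \+ id \- l.
rewrite (_ : l = u0 \+ id \- gap); last first.
  by apply/funext => t; rewrite /gap/=; lra.
apply: bounded_variationD => //; last first.
  apply: bounded_variationN; apply: nondecreasing_bounded_variation => x y.
  rewrite !in_itv/= => /andP[x0 _] _ xy.
  have yE : x + (y - x) = y by lra.
  have := @solution_increment l eql x (y - x) x0.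
  by rewrite yE subr_ge0 /gap/= => /(_ xy); lra.
apply: bounded_variationD => //; first exact: u0_BV.
exact: nondecreasing_bounded_variation.
Qed.

Lemma solution_le_supnorm l : solves_equation u0 l ->
  forall t, 0 <= t -> ((l t)%:E <= supnorm u0 + t%:E)%E.
Proof.
move=> /solves_equationP eql t t0; rewrite eql// /delay_rhs EFinD; apply: leeD.
  apply: (@le_trans _ _ `|u0 t|%:E); first by rewrite lee_fin ler_norm.
  by apply: ereal_sup_ubound; exists t => //=; rewrite in_itv/= t0.
by rewrite lee_fin active_measure_le.
Qed.

End Equation.

Theorem theorem4p1 (R : realType) (u0 : R -> R) (alpha : R)
  (u0_BV : BVloc u0)
  (u0_rc : right_continuous_on_halfline u0)
  (u0_ge0 : nonneg_on_halfline u0)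
  (alpha_gt0 : 0 < alpha)
  (u0_alpha : forall t : R, 0 <= t -> t < alpha -> alpha <= u0 t) :
  exists l : R -> R,
    [/\ is_solution u0 l,
        (forall l' : R -> R, is_solution u0 l' ->
           forall t : R, 0 <= t -> l' t = l t),
        (forall t : R, 0 <= t -> alpha <= l t),
        (forall t : R, 0 <= t -> ((l t)%:E <= supnorm u0 + t%:E)%E) &
        (forall t tau : R, 0 < t -> 0 <= tau ->
           l (t + tau) - l t <= u0 (t + tau) - u0 t + tau)].
Proof.
exists (eventual_iterate u0 alpha).
have eql := eventual_iterate_solves u0_ge0 alpha_gt0 u0_alpha.
have la := solution_ge u0_ge0 alpha_gt0 u0_alpha eql.
split => //.
- split => //; last exact: solution_BVloc u0_BV eql.
  by move=> t t0; rewrite (le_trans (ltW alpha_gt0))// la.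
- move=> l' [_ _ eql'] t.
  exact: (solution_unique u0_ge0 alpha_gt0 u0_alpha eql eql').
- by move=> t; exact: (solution_le_supnorm eql).
- by move=> t tau /ltW; exact: (solution_increment eql).
Qed.
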